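(* Let $(\lambda_0,\lambda_1,\lambda_2,\lambda_3)\in\mathbb{C}^4$ and $\delta>0$, and suppose that $\Phi_{(\lambda_0,\lambda_1)}(x)\Phi_{(\lambda_2,\lambda_3)}(x)\neq0$ for all $x\in[-\delta,\delta]\setminus\{0\}$. Assume that $\rho(x)$ and $-\rho(-x)$ are (real and) positive for $x\in(0,\delta)$, and let $M_\delta>0$ be such that $$|\sigma(-x)|\le M_\delta|\rho(x)|\quad\text{for all }x\in[-\delta,\delta].$$ Then the estimate $$|R_{j,j-1}|+|R_{j,j+1}|\le M_\delta|R_{j,j}|,\qquad j=2,\dots,n-1,$$ holds for all $n\ge3$ and all partitions $t_1<\dots<t_n$ such that $t_{j+1}-t_j\le\delta$ for $j=1,\dots,n-1$.
   Context: For $(\mu_0,\dots,\mu_N)\in\mathbb{C}^{N+1}$ let $\Phi_{(\mu_0,\dots,\mu_N)}$ (the fundamental function) be the unique solution of $\prod_{j=0}^N(\frac{d}{dx}-\mu_j)\Phi=0$ on $\mathbb{R}$ with $\Phi^{(k)}(0)=0$ for $k=0,\dots,N-1$ and $\Phi^{(N)}(0)=1$. Define $$\rho(x)=\frac{\Phi'_{(\lambda_0,\dots,\lambda_3)}(x)\Phi_{(\lambda_0,\lambda_1)}(x)-\Phi_{(\lambda_0,\dots,\lambda_3)}(x)\Phi'_{(\lambda_0,\lambda_1)}(x)}{\Phi_{(\lambda_0,\lambda_1)}(x)\Phi_{(\lambda_2,\lambda_3)}(x)},\qquad \sigma(x)=\frac{\Phi_{(\lambda_0,\dots,\lambda_3)}(x)}{\Phi_{(\lambda_0,\lambda_1)}(x)\Phi_{(\lambda_2,\lambda_3)}(x)},$$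 extended by continuity at the removable singularity $x=0$ (both have value $0$ there). For $t_1<\dots<t_n$ and $j=2,\dots,n-1$ the entries of the tridiagonal matrix $R$ are $$R_{j,j}=\rho(t_j-t_{j-1})-\rho(-(t_{j+1}-t_j)),\quad R_{j,j+1}=\sigma(t_{j+1}-t_j),\quad R_{j,j-1}=-\sigma(-(t_j-t_{j-1})).$$ (The $(n-2)\times(n-2)$ matrix is $R=(R_{i,j})_{2\le i,j\le n-1}$; the numbers $R_{2,1}$ and $R_{n-1,n}$ are also defined by these formulas.) *)

(* Defs.v *)
From Stdlib Require Import Reals Lra Lia Arith List.
From Coquelicot Require Import Coquelicot.
Import ListNotations.
Open Scope R_scope.

(** Derivative of a complex-valued function of a real variable.  It is total;
    it is meaningful only under [ex_derive], see [Cderive_correct]. *)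
Definition Cderive (f : R -> C) (x : R) : C :=
  (Derive (fun t => Re (f t)) x, Derive (fun t => Im (f t)) x).

Lemma Cderive_unique (f : R -> C) (x : R) (l : C) :
  @is_derive R_AbsRing C_R_NormedModule f x l -> Cderive f x = l.
Proof.
  intros Hf.
  unfold Cderive; rewrite (surjective_pairing l); f_equal.
  - apply is_derive_unique.
    apply (filterdiff_comp' f (fun z : C => Re z) x _ (fun z : C => Re z) Hf).
    apply filterdiff_linear, is_linear_fst.
  - apply is_derive_unique.
    apply (filterdiff_comp' f (fun z : C => Im z) x _ (fun z : C => Im z) Hf).
    apply filterdiff_linear, is_linear_snd.
Qed.

Lemma Cderive_correct (f : R -> C) (x : R) :
  @ex_derive R_AbsRing C_R_NormedModule f x ->
  @is_derive R_AbsRing C_R_NormedModule f x (Cderive f x).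
Proof. now intros [l Hl]; rewrite (Cderive_unique f x l Hl). Qed.

Fixpoint Cderive_n (f : R -> C) (k : nat) : R -> C :=
  match k with
  | O => f
  | S k => Cderive (Cderive_n f k)
  end.

Definition diff_factor (mu : C) (f : R -> C) : R -> C :=
  fun x => (Cderive f x - mu * f x)%C.

(** [(d/dx - mu_0) ... (d/dx - mu_N) f] for [mus = [mu_0; ...; mu_N]]. *)
Definition diff_prod (mus : list C) (f : R -> C) : R -> C :=
  fold_right diff_factor f mus.

(** [Phi] is the fundamental function of the [N + 1] complex numbers [mus].
    The first clause says that [Phi] is [N + 1] times differentiable, so that
    the total derivatives occurring in the other clauses are genuine. *)
Definition is_fundamental (mus : list C) (Phi : R -> C) : Prop :=
  let N := pred (length mus) in
  (forall (k : nat) (x : R), (k <= N)%nat ->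
     @ex_derive R_AbsRing C_R_NormedModule (Cderive_n Phi k) x) /\
  (forall x : R, diff_prod mus Phi x = RtoC 0) /\
  (forall k : nat, (k < N)%nat -> Cderive_n Phi k 0 = RtoC 0) /\
  Cderive_n Phi N 0 = RtoC 1.

(** In [rho_fun] and [sigma_fun], the arguments [F], [F01], [F23] stand for the
    fundamental functions of [(lambda_0, ..., lambda_3)],
    [(lambda_0, lambda_1)] and [(lambda_2, lambda_3)].  The value [0] at
    [x = 0] is the extension by continuity: there [F x ~ x^3/6] while [F01 x]
    and [F23 x] are equivalent to [x]. *)
Definition rho_fun (F F01 F23 : R -> C) (x : R) : C :=
  if Req_EM_T x 0 then RtoC 0
  else ((Cderive F x * F01 x - F x * Cderive F01 x) / (F01 x * F23 x))%C.

Definition sigma_fun (F F01 F23 : R -> C) (x : R) : C :=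
  if Req_EM_T x 0 then RtoC 0
  else (F x / (F01 x * F23 x))%C.

(** Entry [(i, j)] of the tridiagonal matrix attached to the nodes
    [t 1 < ... < t n]; only rows [2 <= i <= n - 1] are meaningful. *)
Definition Rmat (F F01 F23 : R -> C) (t : nat -> R) (i j : nat) : C :=
  if Nat.eqb j i then
    (rho_fun F F01 F23 (t i - t (i - 1)%nat)
     - rho_fun F F01 F23 (- (t (i + 1)%nat - t i)))%C
  else if Nat.eqb j (i + 1) then
    sigma_fun F F01 F23 (t (i + 1)%nat - t i)
  else if Nat.eqb (j + 1) i then
    (- sigma_fun F F01 F23 (- (t i - t (i - 1)%nat)))%C
  else RtoC 0.

Definition real_positive (z : C) : Prop := Im z = 0 /\ 0 < Re z.

(* Main.v *)
Require Import Defs.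
From Stdlib Require Import Reals Lra Lia Arith List.
From Coquelicot Require Import Coquelicot.
Import ListNotations.
Open Scope R_scope.

(** Put [h = t_j - t_{j-1}] and [k = t_{j+1} - t_j], both in [(0, delta]].
    The bound on [sigma], taken at [h] and at [-k], estimates the two
    off-diagonal entries by [M |rho h|] and [M |rho (-k)|].  The diagonal entry
    is [rho h + (- rho (-k))], a sum of two nonnegative reals, so its modulus
    is exactly [|rho h| + |rho (-k)|]: the triangle inequality is an equality
    ([Cmod_plus_nonneg]) and the two estimates add up.

    The sign of [rho] is given on the open interval [(0, delta)] only, whereas
    a mesh size may equal [delta].  Away from the zeros of its denominator
    [rho] is a quotient of continuous functions ([continuous_rho_fun]), so at
    [delta] it is a limit of nonnegative reals, hence itself one
    ([real_nonneg_left_limit]); strict positivity could be lost there, but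
    nonnegativity is enough. *)

Definition real_nonneg (z : C) : Prop := Im z = 0 /\ 0 <= Re z.

Lemma real_positive_nonneg (z : C) : real_positive z -> real_nonneg z.
Proof. intros [Him Hre]; split; [exact Him | lra]. Qed.

Lemma Cmod_real_nonneg (z : C) : real_nonneg z -> Cmod z = Re z.
Proof.
  destruct z as [a b]; intros [Him Hre]; cbn in Him, Hre |- *; subst b.
  change (Cmod (RtoC a) = a).
  now rewrite Cmod_R, Rabs_pos_eq.
Qed.

Lemma Cmod_plus_nonneg (z w : C) :
  real_nonneg z -> real_nonneg w -> Cmod (z + w) = Cmod z + Cmod w.
Proof.
  intros Hz Hw.
  rewrite (Cmod_real_nonneg z Hz), (Cmod_real_nonneg w Hw).
  apply Cmod_real_nonneg.
  destruct Hz as [Hz1 Hz2], Hw as [Hw1 Hw2].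
  destruct z, w; unfold real_nonneg in *; cbn in *; lra.
Qed.

Lemma continuous_Re {U : UniformSpace} (f : U -> C) (x : U) :
  continuous f x -> continuous (fun y => Re (f y)) x.
Proof.
  intros Hf; apply (continuous_comp f fst x Hf).
  destruct (f x); apply continuous_fst.
Qed.

Lemma continuous_Im {U : UniformSpace} (f : U -> C) (x : U) :
  continuous f x -> continuous (fun y => Im (f y)) x.
Proof.
  intros Hf; apply (continuous_comp f snd x Hf).
  destruct (f x); apply continuous_snd.
Qed.

Lemma continuous_C_pair {U : UniformSpace} (f g : U -> R) (x : U) :
  continuous f x -> continuous g x ->
  continuous (fun y => (f y, g y) : C) x.
Proof.
  intros Hf Hg.
  apply (continuous_comp_2 f g (fun a b => (a, b) : C) x Hf Hg).
  apply (continuous_ext (fun z : R * R => z)).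
  - now intros [a b].
  - apply continuous_id.
Qed.

Lemma continuous_Cmult {U : UniformSpace} (f g : U -> C) (x : U) :
  continuous f x -> continuous g x -> continuous (fun y => (f y * g y)%C) x.
Proof.
  intros Hf Hg.
  pose proof (continuous_Re f x Hf); pose proof (continuous_Im f x Hf).
  pose proof (continuous_Re g x Hg); pose proof (continuous_Im g x Hg).
  apply continuous_C_pair.
  - apply (continuous_minus (V := R_NormedModule));
      now apply (continuous_mult (K := R_AbsRing)).
  - apply (continuous_plus (V := R_NormedModule));
      now apply (continuous_mult (K := R_AbsRing)).
Qed.

Lemma continuous_Cinv {U : UniformSpace} (f : U -> C) (x : U) :
  continuous f x -> f x <> RtoC 0 -> continuous (fun y => (/ f y)%C) x.
Proof.
  intros Hf Hnz.
  pose proof (continuous_Re f x Hf) as Hre.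
  pose proof (continuous_Im f x Hf) as Him.
  assert (Hinv : continuous (fun y => / (Re (f y) ^ 2 + Im (f y) ^ 2)) x).
  { apply (continuous_comp (fun y => Re (f y) ^ 2 + Im (f y) ^ 2) Rinv).
    - apply (continuous_plus (V := R_NormedModule)).
      + cbn; repeat apply (continuous_mult (K := R_AbsRing));
          auto using continuous_const.
      + cbn; repeat apply (continuous_mult (K := R_AbsRing));
          auto using continuous_const.
    - apply continuous_Rinv; intros H0; apply Hnz.
      destruct (f x) as [a b]; cbn in H0.
      unfold RtoC; f_equal; nra. }
  apply continuous_C_pair.
  - now apply (continuous_mult (K := R_AbsRing)).
  - apply (continuous_mult (K := R_AbsRing)); [| exact Hinv].
    now apply (continuous_opp (V := R_NormedModule)).
Qed.

Lemma closed_real_nonneg : closed real_nonneg.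
Proof.
  apply closed_and.
  - apply (closed_comp Im (fun u => u = 0)); [| apply closed_eq].
    intros z; apply continuous_Im, continuous_id.
  - apply (closed_comp Re (fun u => 0 <= u)); [| apply closed_ge].
    intros z; apply continuous_Re, continuous_id.
Qed.

Lemma real_nonneg_left_limit (f : R -> C) (a b : R) :
  a < b -> continuous f b ->
  (forall x, a < x < b -> real_nonneg (f x)) -> real_nonneg (f b).
Proof.
  intros Hab Hf Hpos.
  apply (closed_filterlim_loc (F := at_left b) f real_nonneg).
  - apply filterlim_filter_le_1 with (2 := Hf), filter_le_within.
  - assert (Hba : 0 < b - a) by lra.
    exists (mkposreal _ Hba); intros x Hx Hxb.
    apply Hpos; split; [| exact Hxb].
    apply Rabs_lt_between' in Hx; cbn in Hx; lra.
  - exact closed_real_nonneg.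
Qed.

Lemma fundamental_continuous (mus : list C) (Phi : R -> C) (k : nat) (x : R) :
  is_fundamental mus Phi -> (k <= pred (length mus))%nat ->
  continuous (Cderive_n Phi k) x.
Proof.
  intros [Hd _] Hk.
  exact (ex_derive_continuous (V := C_R_NormedModule) _ x (Hd k x Hk)).
Qed.

Lemma continuous_rho_fun (F F01 F23 : R -> C) (x : R) :
  continuous F x -> continuous (Cderive F) x ->
  continuous F01 x -> continuous (Cderive F01) x -> continuous F23 x ->
  x <> 0 -> (F01 x * F23 x)%C <> RtoC 0 ->
  continuous (rho_fun F F01 F23) x.
Proof.
  intros HF HF' HF01 HF01' HF23 Hx Hnz.
  apply (continuous_ext_loc _ (fun y =>
    ((Cderive F y * F01 y - F y * Cderive F01 y) / (F01 y * F23 y))%C)).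
  - (* The exceptional value at 0 is not seen near [x]. *)
    apply Rabs_pos_lt in Hx.
    exists (mkposreal _ Hx); intros y Hy.
    unfold rho_fun; destruct (Req_EM_T y 0) as [-> |]; [exfalso | reflexivity].
    change (Rabs (0 - x) < Rabs x) in Hy.
    rewrite Rabs_minus_sym, Rminus_0_r in Hy; lra.
  - apply continuous_Cmult.
    + apply (continuous_minus (V := C_R_NormedModule));
        now apply continuous_Cmult.
    + apply continuous_Cinv; [now apply continuous_Cmult | exact Hnz].
Qed.

Theorem theorem14
  (l0 l1 l2 l3 : C) (delta M : R) (Phi Phi01 Phi23 : R -> C)
  (HPhi : is_fundamental [l0; l1; l2; l3] Phi)
  (HPhi01 : is_fundamental [l0; l1] Phi01)
  (HPhi23 : is_fundamental [l2; l3] Phi23)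
  (Hdelta : 0 < delta)
  (Hnz : forall x : R, - delta <= x <= delta -> x <> 0 ->
     (Phi01 x * Phi23 x)%C <> RtoC 0)
  (Hrho : forall x : R, 0 < x < delta ->
     real_positive (rho_fun Phi Phi01 Phi23 x) /\
     real_positive (- rho_fun Phi Phi01 Phi23 (- x))%C)
  (HM : 0 < M)
  (Hsigma : forall x : R, - delta <= x <= delta ->
     Cmod (sigma_fun Phi Phi01 Phi23 (- x)) <= M * Cmod (rho_fun Phi Phi01 Phi23 x)) :
  forall (n : nat) (t : nat -> R),
    (3 <= n)%nat ->
    (forall j : nat, (1 <= j <= n - 1)%nat -> t j < t (j + 1)%nat) ->
    (forall j : nat, (1 <= j <= n - 1)%nat -> t (j + 1)%nat - t j <= delta) ->
    forall j : nat, (2 <= j <= n - 1)%nat ->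
      Cmod (Rmat Phi Phi01 Phi23 t j (j - 1))
        + Cmod (Rmat Phi Phi01 Phi23 t j (j + 1))
      <= M * Cmod (Rmat Phi Phi01 Phi23 t j j).
Proof.
  intros n t Hn Hmono Hmesh j Hj.
  set (rho := rho_fun Phi Phi01 Phi23) in *.
  set (sigma := sigma_fun Phi Phi01 Phi23) in *.
  assert (Hcont : forall x, - delta <= x <= delta -> x <> 0 -> continuous rho x).
  { intros x Hx Hx0; apply continuous_rho_fun; auto.
    - apply (fundamental_continuous _ Phi 0 x HPhi); cbn; lia.
    - apply (fundamental_continuous _ Phi 1 x HPhi); cbn; lia.
    - apply (fundamental_continuous _ Phi01 0 x HPhi01); cbn; lia.
    - apply (fundamental_continuous _ Phi01 1 x HPhi01); cbn; lia.
    - apply (fundamental_continuous _ Phi23 0 x HPhi23); cbn; lia. }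
  assert (Hright : forall x, 0 < x <= delta -> real_nonneg (rho x)).
  { intros x [Hx0 Hx]; apply (real_nonneg_left_limit rho 0); trivial.
    - apply Hcont; lra.
    - intros y Hy; apply real_positive_nonneg, Hrho; lra. }
  assert (Hleft : forall x, 0 < x <= delta -> real_nonneg (- rho (- x)%R)%C).
  { intros x [Hx0 Hx].
    apply (real_nonneg_left_limit (fun y => (- rho (- y)%R)%C) 0); trivial.
    - apply (continuous_opp (V := C_R_NormedModule)).
      apply (continuous_comp Ropp rho).
      + apply (continuous_opp (V := R_NormedModule)), continuous_id.
      + apply Hcont; lra.
    - intros y Hy; apply real_positive_nonneg, Hrho; lra. }
  pose proof (Hmono (j - 1)%nat ltac:(lia)) as Hh0.
  pose proof (Hmesh (j - 1)%nat ltac:(lia)) as Hh.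
  pose proof (Hmono j ltac:(lia)) as Hk0.
  pose proof (Hmesh j ltac:(lia)) as Hk.
  replace (j - 1 + 1)%nat with j in Hh0, Hh by lia.
  unfold Rmat; fold rho sigma.
  replace (j - 1 =? j)%nat with false by (symmetry; apply Nat.eqb_neq; lia).
  replace (j - 1 =? j + 1)%nat with false by (symmetry; apply Nat.eqb_neq; lia).
  replace (j - 1 + 1 =? j)%nat with true by (symmetry; apply Nat.eqb_eq; lia).
  replace (j + 1 =? j)%nat with false by (symmetry; apply Nat.eqb_neq; lia).
  rewrite !Nat.eqb_refl.
  set (h := t j - t (j - 1)%nat) in *.
  set (k := t (j + 1)%nat - t j) in *.
  assert (0 < h <= delta) by (unfold h in *; lra).
  assert (0 < k <= delta) by (unfold k in *; lra).
  unfold Cminus.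
  rewrite Cmod_plus_nonneg by auto.
  rewrite !Cmod_opp.
  pose proof (Hsigma h ltac:(lra)) as Sh.
  pose proof (Hsigma (- k) ltac:(lra)) as Sk.
  rewrite Ropp_involutive in Sk.
  lra.
Qed.
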